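(* Let $(X,d)$ be a controlled metric type space with control function $\alpha : X\times X\to[1,\infty)$, let $r\ge 0$ be a real number, let $\{x_n\}_{n\in\mathbb N}$ be a sequence in $X$, and let $\{x_{n_i}\}_{i\in\mathbb N}$ be a subsequence of $\{x_n\}$. Then $LIM^{r}x_n\subseteq LIM^{r}x_{n_i}$.
   Context: A controlled metric type space is a nonempty set $X$ with functions $\alpha: X\times X\to[1,\infty)$ and $d:X\times X\to[0,\infty)$ such that for all $x,y,z\in X$: $d(x,y)=0$ iff $x=y$; $d(x,y)=d(y,x)$; and $d(x,y)\le \alpha(x,z)d(x,z)+\alpha(z,y)d(z,y)$. (No symmetry of $\alpha$ is assumed.) For a real $r\ge0$, a sequence $\{x_n\}$ in $X$ is $r$-convergent (rough convergent of roughness degree $r$) to $x\in X$ if for every $\varepsilon>0$ there is $n_0\in\mathbb N$ with $d(x_n,x)<r+\varepsilon$ for all $n\ge n_0$. The $r$-limit set $LIM^{r}x_n$ is the set of all $x\in X$ to which $\{x_n\}$ is $r$-convergent. *)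

(* Defs.v *)
From mathcomp Require Import all_boot all_order all_algebra.
From mathcomp Require Import classical_sets reals.
Set Implicit Arguments.
Unset Strict Implicit.
Unset Printing Implicit Defensive.
Import Order.TTheory GRing.Theory Num.Theory.
Local Open Scope ring_scope.
Local Open Scope classical_set_scope.

(* No symmetry of [alpha] is required: the order of its arguments in
   [cm_triangle] matters. *)
Record controlled_metric (R : realType) (X : Type)
    (alpha d : X -> X -> R) : Prop := ControlledMetric {
  cm_nonempty : [set: X] !=set0;
  cm_alpha_ge1 : forall x y, 1 <= alpha x y;
  cm_ge0 : forall x y, 0 <= d x y;
  cm_eq0 : forall x y, d x y = 0 <-> x = y;
  cm_sym : forall x y, d x y = d y x;
  cm_triangle : forall x y z,
    d x y <= alpha x z * d x z + alpha z y * d z y }.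

Definition rough_cvg (R : realType) (X : Type) (d : X -> X -> R) (r : R)
    (u : nat -> X) (x : X) : Prop :=
  forall e : R, 0 < e ->
    exists n0 : nat, forall n : nat, (n0 <= n)%N -> d (u n) x < r + e.

Definition rough_LIM (R : realType) (X : Type) (d : X -> X -> R) (r : R)
    (u : nat -> X) : set X :=
  [set x | rough_cvg d r u x].

Definition subsequence (X : Type) (v u : nat -> X) : Prop :=
  exists2 k : nat -> nat,
    {homo k : i j / (i < j)%N} & forall i, v i = u (k i).

(* Main.v *)
Require Import Defs.
From mathcomp Require Import all_boot all_order all_algebra.
From mathcomp Require Import classical_sets reals.
Local Open Scope ring_scope.
Local Open Scope classical_set_scope.

(** A strictly increasing index map never falls behind the identity ([leq_increasing]), so any
    threshold that works for the sequence at a given [e] works unchanged for the subsequence. *)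

Lemma leq_increasing (k : nat -> nat) :
  {homo k : i j / (i < j)%N} -> forall n, (n <= k n)%N.
Proof.
move=> k_incr; elim=> [|n IHn] //.
(* The goal [n.+1 <= k n.+1] is [n < k n.+1], obtained from [n <= k n < k n.+1]. *)
exact: leq_ltn_trans IHn (k_incr _ _ (ltnSn n)).
Qed.

Theorem theorem3p12 (R : realType) (X : Type) (alpha d : X -> X -> R)
  (hX : controlled_metric alpha d) (r : R) (hr : 0 <= r)
  (x y : nat -> X) (hxy : subsequence y x) :
  rough_LIM d r x `<=` rough_LIM d r y.
Proof.
case: hxy => k k_incr y_def l cvg_x e e_gt0.
have [n0 Hn0] := cvg_x e e_gt0.
(* The same [n0] serves, since [n0 <= n <= k n]. *)
exists n0 => n le_n0n; rewrite y_def; apply: Hn0.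
exact: leq_trans le_n0n (leq_increasing k k_incr n).
Qed.
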